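(* Let $m \geq 3$ be odd and let $d$ be an integer with $2m-3 \leq d \leq 2m+1$. Then $\beta_{2m}(d) = \mathsf{s}_{2m}(\mathbb{Z}_2^d) - 1$.
   Context: $\mathsf{s}_{2m}(\mathbb{Z}_2^d)$ denotes the smallest integer $s$ such that every sequence (repetitions allowed) of length $s$ of elements of $\mathbb{Z}_2^d$ has a subsequence of length $2m$ whose elements sum to $0$. $\beta_{2m}(d)$ denotes the largest size of a set $A \subseteq \mathbb{Z}_2^d$ (of distinct elements) with no $2m$-element subset summing to $0$. *)

(* Defs.v *)
From mathcomp Require Import all_boot all_order all_algebra.

Set Implicit Arguments.
Unset Strict Implicit.
Unset Printing Implicit Defensive.

Import GRing.Theory.

(** The group Z_2^d is the row-vector space ['rV['F_2]_d]. *)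

Definition has_zero_sum_subseq (n d : nat) (s : seq 'rV['F_2]_d) : bool :=
  [exists t : n.-tuple 'rV['F_2]_d, subseq t s && (\sum_(x <- t) x == 0)%R].

Definition forces_zero_sum (n d k : nat) : bool :=
  [forall s : k.-tuple 'rV['F_2]_d, has_zero_sum_subseq n s].

(** The minimum below exists only because [2 * m] is even: among
    [2 * m * 2^d + 1] terms some element is repeated [2 * m] times.  For
    odd lengths and [0 < d] no [k] works: take a constant nonzero sequence. *)
Lemma forces_zero_sum_exists (m d : nat) :
  exists k, forces_zero_sum (2 * m) d k.
Proof.
pose T : finType := 'rV['F_2]_d.
exists (2 * m * #|T|).+1; apply/forallP => s.
have [x Hx] : exists x : T, 2 * m <= count_mem x s.
  apply/existsP; apply: contraT; rewrite negb_exists => /forallP small.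
  have: \sum_(x : T) count_mem x s <= \sum_(x : T) 2 * m.
    by apply: leq_sum => x _; have := small x; rewrite -ltnNge => /ltnW.
  suff -> : \sum_(x : T) count_mem x s = size s.
    by rewrite size_tuple sum_nat_const [X in _ < X]mulnC ltnn.
  elim: (tval s) => [|y r IHr] /=; first by rewrite big1.
  rewrite big_split /= IHr (bigD1 y) //= eqxx big1 ?addn0 // => z.
  by rewrite eq_sym => /negbTE ->.
apply/existsP; exists [tuple of nseq (2 * m) x]; apply/andP; split.
  apply: (subseq_trans _ (filter_subseq (pred1 x) s)).
  have -> : filter (pred1 x) s = nseq (count_mem x s) x.
    by rewrite -size_filter; apply/all_pred1P/filter_all.
  rewrite -(subnK Hx) nseqD.
  exact: suffix_subseq.
have -> : (\sum_(y <- nseq (2 * m) x) y = x *+ (2 * m))%R.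
  by rewrite big_nseq -Monoid.iteropE.
rewrite mulrnA (_ : x *+ 2 = 0)%R ?mul0rn //.
by rewrite -scaler_nat (_ : 2%:R = 0 :> 'F_2)%R ?scale0r //; apply/val_inj.
Qed.

(** [s2 m d] is s_{2m}(Z_2^d). *)
Definition s2 (m d : nat) : nat := ex_minn (forces_zero_sum_exists m d).

Definition zero_sum_free (n d : nat) (A : {set 'rV['F_2]_d}) : bool :=
  [forall B : {set 'rV['F_2]_d},
     (B \subset A) && (#|B| == n) ==> (\sum_(x in B) x != 0)%R].

(** [beta2 m d] is beta_{2m}(d). *)
Definition beta2 (m d : nat) : nat :=
  \max_(A : {set 'rV['F_2]_d} | zero_sum_free (2 * m) A) #|A|.

(* Main.v *)
(** Even zero-sum subsets of a sequence of length n in Z_2^d form a linear code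
    of length n and dimension at least n - d - 1 with even weights, so everything
    reduces to codes avoiding the weight t = 2m.

    Upper bounds.  In a flat L, restrict to the words separating two coordinates
    i, j and delete both: the length drops by 2, the target weight by 1 and the
    dimension by at most 1, unless L is invariant under translation by e_i + e_j.
    Induction gives a word of weight t whenever the length is 2t + 1 and the
    dimension t, or the length is 2t - 1 and the dimension t - 1; this settles
    d <= 2m.  For length 2t + 2 and dimension t the same reduction, always
    separating i and j in two chosen words z (of weight < t) and a (of weight = t
    mod 4), shows that an avoiding linear code is doubly even with t = 2 mod 4.
    Applied to all shortenings at three coordinates of a code of length 2t + 5 and
    dimension t + 3, it makes that code doubly even, hence self-orthogonal, which
    contradicts its dimension; this settles d = 2m + 1.

    Lower bounds.  As 2m = 2 mod 4, a set all of whose even zero-sum subsets have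
    size divisible by 4 suffices: {0, e_1, .., e_(d-1), e_1 + .. + e_(d-1)} x Z_2
    when d = 3 mod 4, and {0, e_1, .., e_(d-1)} x Z_2 for d = 2m.  For d = 2m - 2
    and d = 2m - 1 add independent vectors to the case d = 2m - 3. *)

Require Import Defs.
From mathcomp Require Import all_boot all_order all_algebra.
From mathcomp Require Import zify.

Set Implicit Arguments.
Unset Strict Implicit.
Unset Printing Implicit Defensive.

Import GRing.Theory.

(** * Flats of words *)

Section Words.
Variable T : finType.
Implicit Types (a b c g z S W I : {set T}) (L : {set {set T}}) (i j k : T).

(** Binary words are identified with their supports, so [sd] is their addition. *)
Definition sd a b := [set x | (x \in a) (+) (x \in b)].

Lemma in_sd a b x : (x \in sd a b) = (x \in a) (+) (x \in b).
Proof. by rewrite inE. Qed.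

Lemma sdC a b : sd a b = sd b a.
Proof. by apply/setP => x; rewrite !in_sd addbC. Qed.

Lemma sdA a b c : sd a (sd b c) = sd (sd a b) c.
Proof. by apply/setP => x; rewrite !in_sd addbA. Qed.

Lemma sd0 a : sd a set0 = a.
Proof. by apply/setP => x; rewrite in_sd inE addbF. Qed.

Lemma sdd a : sd a a = set0.
Proof. by apply/setP => x; rewrite in_sd addbb inE. Qed.

Lemma sdK a b : sd (sd a b) b = a.
Proof. by rewrite -sdA sdd sd0. Qed.

Lemma sd_inj b : injective (sd^~ b).
Proof. by move=> a a' /(congr1 (sd^~ b)); rewrite !sdK. Qed.

Lemma sd_eq0 a b : sd a b = set0 -> a = b.
Proof. by move=> h; rewrite -[a](sdK a b) h sdC sd0. Qed.

Lemma card_sd a b : #|sd a b| + 2 * #|a :&: b| = #|a| + #|b|.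
Proof.
have -> : sd a b = (a :\: b) :|: (b :\: a).
  by apply/setP => x; rewrite !inE; case: (x \in a); case: (x \in b).
rewrite cardsU (_ : _ :&: _ = set0); last first.
  by apply/setP => x; rewrite !inE; case: (x \in a); case: (x \in b).
rewrite cards0 -(cardsID b a) -(cardsID a b) [b :&: a]setIC; lia.
Qed.

Lemma odd_card_sd a b : odd #|sd a b| = odd #|a| (+) odd #|b|.
Proof. have := card_sd a b; lia. Qed.

Lemma odd_cardI_sd a b c :
  odd #|sd a b :&: c| = odd #|a :&: c| (+) odd #|b :&: c|.
Proof.
have -> : sd a b :&: c = sd (a :&: c) (b :&: c).
  by apply/setP => x; rewrite !inE; case: (x \in c); rewrite ?andbT ?andbF.
exact: odd_card_sd.
Qed.

Lemma subset_of_card W n : n <= #|W| -> exists2 c : {set T}, c \subset W & #|c| = n.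
Proof.
move=> nW; exists [set x in take n (enum W)].
  by apply/subsetP => x; rewrite inE => /mem_take; rewrite mem_enum.
have /card_uniqP h : uniq (take n (enum W)) by rewrite take_uniq ?enum_uniq.
by rewrite cardsE h size_takel // -cardE.
Qed.

(** * Affine flats over F_2 and twin coordinates *)

Definition flat L := forall a b c, a \in L -> b \in L -> c \in L ->
  sd (sd a b) c \in L.

Definition twin L i j := [forall c in L, sd c (sd [set i] [set j]) \in L].

Lemma in_edge i j x : (x \in sd [set i] [set j]) = (x == i) (+) (x == j).
Proof. by rewrite in_sd !inE. Qed.

Lemma twinP L i j :
  reflect (forall c, c \in L -> sd c (sd [set i] [set j]) \in L) (twin L i j).
Proof. exact: forall_inP. Qed.

Lemma twin_sym L i j : twin L i j -> twin L j i.
Proof. by move=> /twinP h; apply/twinP => c /h; rewrite [sd [set i] _]sdC. Qed.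

Lemma twin_trans L i j k : twin L i j -> twin L j k -> twin L i k.
Proof.
move=> /twinP h1 /twinP h2; apply/twinP => c /h1 /h2.
congr (_ \in L); apply/setP => x; rewrite !in_sd !inE.
by case: (x \in c); case: (x == i); case: (x == j); case: (x == k).
Qed.

Lemma twin_one L i j c : flat L -> c \in L ->
  sd c (sd [set i] [set j]) \in L -> twin L i j.
Proof.
move=> fL cL eL; apply/twinP => b bL; have := fL _ _ _ eL cL bL.
by congr (_ \in L); apply/setP => x; rewrite !in_sd; do !case: (x \in _).
Qed.

Lemma card_edgeI c i j : (i \in c) != (j \in c) -> #|c :&: [set i; j]| = 1.
Proof.
wlog ic : i j / i \in c => [hw h|].
  case: (boolP (i \in c)) => ic; first exact: hw.
  by rewrite setUC; apply: hw; move: h; rewrite (negbTE ic) //; case: (j \in c).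
rewrite ic; case: (boolP (j \in c)) => // jc _.
suff -> : c :&: [set i; j] = [set i] by rewrite cards1.
apply/setP => x; rewrite !inE; case: (eqVneq x i) => [->|_]; first by rewrite ic.
by case: (eqVneq x j) => [->|_]; rewrite ?andbF // (negbTE jc).
Qed.

Lemma edgeE i j : i != j -> sd [set i] [set j] = [set i; j].
Proof.
move=> ij; apply/setP => x; rewrite !inE.
by case: eqP => // ->; rewrite (negbTE ij).
Qed.

Lemma card_sd_edge c i j : (i \in c) != (j \in c) ->
  #|sd c (sd [set i] [set j])| = #|c|.
Proof.
move=> hij; have ij : i != j by apply: contraNneq hij => ->.
have := card_sd c [set i; j]; rewrite edgeE // card_edgeI // cards2 ij; lia.
Qed.

(** The points where [b] and [c] differ lie in [S] and are even in number, so translations along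
    pairs of twins remove them two at a time. *)
Lemma twins_word L S c b : flat L -> {in S &, forall i j, twin L i j} ->
  c \in L -> b :\: S = c :\: S -> odd #|b| = odd #|c| -> b \in L.
Proof.
move=> fL tS; have [n] := ubnP #|sd c b|; elim: n c => // n IH c le_n cL eS op.
have [/sd_eq0 <- //|/set0Pn [x xcb]] := eqVneq (sd c b) set0.
have sdS y : y \in sd c b -> y \in S.
  move=> ycb; apply/negPn/negP => yS; move/setP/(_ y): eS.
  by move: ycb; rewrite !inE yS /=; do !case: (y \in _).
have [y ycb yx] : exists2 y, y \in sd c b & y != x.
  apply/exists_inP; apply: contraT; rewrite negb_exists_in => /forall_inP h.
  have E : sd c b = [set x].
    apply/setP => y; rewrite in_set1; apply/idP/eqP => [/h|-> //].
    by rewrite negbK => /eqP.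
  by have := odd_card_sd c b; rewrite E cards1 op addbb.
have /twinP /(_ c cL) c'L := tS x y (sdS _ xcb) (sdS _ ycb).
set e := sd [set x] [set y] in c'L *.
have ce : #|e| = 2 by rewrite /e edgeE 1?eq_sym // cards2 eq_sym yx.
have eI : sd c b :&: e = e.
  apply/setIidPr/subsetP => w; rewrite in_edge.
  by case: (eqVneq w x) => [-> //|_]; case: (eqVneq w y) => [->|].
apply: (IH (sd c e)) => //.
- have -> : sd (sd c e) b = sd (sd c b) e by rewrite -[LHS]sdA [sd e b]sdC sdA.
  have := card_sd (sd c b) e; rewrite eI ce; lia.
- rewrite eS; apply/setP => w; rewrite !in_setD !in_sd in_set1.
  case: (boolP (w \in S)) => //= wS.
  have -> : (w == x) = false by apply: contraNF wS => /eqP ->; exact: sdS.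
  have -> : (w \in [set y]) = false.
    by rewrite in_set1; apply: contraNF wS => /eqP ->; exact: sdS.
  by rewrite !addbF.
by rewrite op odd_card_sd ce addbF.
Qed.

Lemma twins_weight L S c t : flat L -> {in S &, forall i j, twin L i j} ->
  c \in L -> odd #|c| = odd t -> #|c :\: S| <= t <= #|c :\: S| + #|S| ->
  exists2 b : {set T}, b \in L & #|b| = t.
Proof.
move=> fL tS cL op /andP[lo hi].
have [R RS cR] : exists2 R : {set T}, R \subset S & #|R| = t - #|c :\: S|.
  by apply: subset_of_card; lia.
have ct : #|(c :\: S) :|: R| = t.
  rewrite cardsU (_ : _ :&: R = set0) ?cards0 ?cR; first by lia.
  apply/setP => x; rewrite !inE; case: (boolP (x \in R)); rewrite ?andbF //.
  by move/(subsetP RS) => ->.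
exists ((c :\: S) :|: R) => //; apply: (twins_word fL tS cL); last by rewrite ct.
apply/setP => x; rewrite !inE; case: (boolP (x \in S)) => //= xS.
by rewrite (contraNF (subsetP RS x) xS) orbF.
Qed.

(** * Splitting a flat at a pair of coordinates *)

Definition cleave L i j :=
  [set c :\: [set i; j] | c in L & (i \in c) != (j \in c)].

Lemma cleaveP L i j b : reflect
  (exists c, [/\ c \in L, (i \in c) != (j \in c) & b = c :\: [set i; j]])
  (b \in cleave L i j).
Proof.
apply: (iffP imsetP) => [[c]|[c [cL h ->]]]; rewrite ?inE.
  by case/andP => cL h ->; exists c.
by exists c; rewrite ?inE ?cL.
Qed.

Lemma card_cleave c i j : (i \in c) != (j \in c) ->
  #|c| = #|c :\: [set i; j]|.+1.
Proof.
by move=> h; rewrite -(cardsID [set i; j] c) card_edgeI.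
Qed.

Lemma cleave_flat L i j : flat L -> flat (cleave L i j).
Proof.
move=> fL a' b' c' /cleaveP [a [aL ha ->]] /cleaveP [b [bL hb ->]].
move=> /cleaveP [c [cL hc ->]]; apply/cleaveP; exists (sd (sd a b) c); split.
- exact: fL.
- rewrite !in_sd; move: ha hb hc.
  by do 6!case: (_ \in _).
by apply/setP => x; rewrite !inE; case: (x == i); case: (x == j).
Qed.

Lemma cleave_sub L i j W : {in L, forall c, c \subset W} ->
  {in cleave L i j, forall c, c \subset W :\: [set i; j]}.
Proof. by move=> LW _ /cleaveP [c [cL _ ->]]; apply: setSD; exact: LW. Qed.

(** Deleting [i] and [j] could only identify words differing by e_i + e_j, which is excluded for
    non-twins. Separating words make up at least half of [L]: if [b] does not separate the pair,
    translation by [sd z b] turns non-separating words into separating ones. *)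
Lemma cleave_card L i j z n : flat L -> ~~ twin L i j ->
  z \in L -> (i \in z) != (j \in z) -> 2 ^ n.+1 <= #|L| ->
  2 ^ n <= #|cleave L i j|.
Proof.
move=> fL ntw zL hz; pose L1 := [set c in L | (i \in c) != (j \in c)].
have ->: #|cleave L i j| = #|L1|.
  rewrite card_in_imset // => a b; rewrite !inE => /andP[aL ha] /andP[bL hb] E.
  have E' x : x != i -> x != j -> (x \in a) = (x \in b).
    by move=> xi xj; move/setP/(_ x): E; rewrite !inE (negbTE xi) (negbTE xj).
  case: (eqVneq (i \in a) (i \in b)) => h.
    apply/setP => x; case: (eqVneq x i) => [-> //|xi].
    case: (eqVneq x j) => [->|xj]; last exact: E'.
    by move: ha hb; rewrite h; case: (i \in b); do 2!case: (j \in _).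
  case/negP: ntw; apply: (twin_one fL aL); suff -> : sd a (sd [set i] [set j]) = b by [].
  have ij : i != j by apply: contraNneq ha => ->.
  apply/setP => x; rewrite !in_sd !in_set1; case: (eqVneq x i) => [->|xi].
    by rewrite (negbTE ij); move: h; do 2!case: (i \in _).
  case: (eqVneq x j) => [->|xj]; last by rewrite !addbF E'.
  by move: ha hb h; do 4!case: (_ \in _).
pose L0 := L :\: L1.
have E : #|L| = #|L1| + #|L0|.
  rewrite -(cardsID L1 L); congr (#|pred_of_set _| + _).
  by apply/setIidPr/subsetP => c; rewrite inE => /andP[].
have le : #|L0| <= #|L1|.
  case: (eqVneq L0 set0) => [->|/set0Pn [b]]; first by rewrite cards0.
  rewrite !inE => /andP[nb bL]; rewrite bL /= negbK in nb.
  rewrite -(card_imset _ (@sd_inj (sd z b))); apply: subset_leq_card.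
  apply/subsetP => _ /imsetP [c + ->]; rewrite !inE => /andP[nc cL].
  rewrite cL /= negbK in nc; rewrite sdA fL //=.
  by rewrite (eqP nc) (eqP nb); move: hz; do !case: (_ \in _).
rewrite expnS; lia.
Qed.

Lemma cleave_odd L i j t : {in L, forall c, odd #|c| = odd t.+1} ->
  {in cleave L i j, forall c, odd #|c| = odd t}.
Proof.
move=> op _ /cleaveP [b [bL hb ->]]; have := op b bL.
by rewrite (card_cleave hb) /= => /negb_inj.
Qed.

Lemma card_setD2 W i j : i != j -> i \in W -> j \in W ->
  #|W| = #|W :\: [set i; j]|.+2.
Proof.
move=> ij iW jW; rewrite -(cardsID [set i; j] W).
suff -> : W :&: [set i; j] = [set i; j] by rewrite cards2 ij.
by apply/setIidPr/subsetP => x; rewrite !inE => /orP[] /eqP ->.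
Qed.

(* Splitting a pair i in c, j outside c keeps the relation between size,
   dimension and target weight; when no such pair is available all
   coordinates are twins, and [L] contains every word of its parity. *)
Lemma flat_middle_weight n W L t : flat L -> {in L, forall c, c \subset W} ->
  {in L, forall c, odd #|c| = odd t} -> #|W| <= n.*2.+1 -> 2 ^ n <= #|L| ->
  n <= t <= n.+1 -> exists2 c : {set T}, c \in L & #|c| = t.
Proof.
elim: n W L t => [|n IH] W L t fL LW op Wn Ln tn.
  have /card_gt0P [c cL] : 0 < #|L| by lia.
  exists c => //; have := op c cL; have := subset_leq_card (LW c cL); lia.
(* If the dimension were #|W|, then [L] would be the whole power set, which has words of both
   parities. *)
have tW : t <= #|W|.
  have := subset_leq_card (_ : L \subset powerset W).
  rewrite card_powerset => /(_ _)/(leq_trans Ln) h.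
  have {h} : n.+1 <= #|W|.
    rewrite -(leq_exp2l (m := 2)) //; apply: h.
    by apply/subsetP => c /LW; rewrite inE.
  rewrite leq_eqVlt => /orP[/eqP E|]; last lia.
  have LE : L = powerset W.
    apply/eqP; rewrite eqEcard card_powerset -E Ln andbT.
    by apply/subsetP => c /LW; rewrite inE.
  have /card_gt0P [x xW] : 0 < #|W| by rewrite -E.
  have h0 : odd #|@set0 T| = odd t by apply: op; rewrite LE inE sub0set.
  have h1 : odd #|[set x]| = odd t by apply: op; rewrite LE inE sub1set.
  by move: h0; rewrite -h1 cards0 cards1.
have [c cL|] := pickP [pred c in L | (c != set0) && (c != W)]; last first.
  (* Here [L] consists of [set0] and [W], so its dimension is one, and parity with [tW] leaves #|W|
     = t = 2. *)
  move=> none; have none' c : c \in L -> c = set0 \/ c = W.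
    move=> cL; have := none c; rewrite /= cL /= => /negbT.
    by rewrite negb_and !negbK => /orP[] /eqP; [left|right].
  have L2 : #|L| <= #|[set set0; W]|.
    apply: subset_leq_card; apply/subsetP => c /none' [] ->; rewrite !inE eqxx //.
    by rewrite orbT.
  move: L2; rewrite cards2 => L2.
  have n0 : n = 0.
    case: n Ln {IH Wn tn} => // n; have := leq_exp2l 2 n.+2 (isT : 1 < 2).
    have := ltn_expl n (isT : 1 < 2); rewrite !expnS; case: (_ != _) L2 => /=; lia.
  rewrite n0 expn1 in Ln.
  have WL : W \in L.
    apply: contraLR Ln => WL; rewrite -ltnNge ltnS -(cards1 (@set0 T)).
    apply: subset_leq_card; apply/subsetP => c cL; rewrite inE.
    by case: (none' c cL) => [->//|cW]; move: cL; rewrite cW (negbTE WL).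
  suff /op : set0 \in L.
    by rewrite cards0 => o0; exists W => //; have := op W WL; lia.
  apply: contraLR Ln => L0; rewrite -ltnNge ltnS -(cards1 W).
  apply: subset_leq_card; apply/subsetP => c cL; rewrite inE.
  by case: (none' c cL) => [c0|->//]; move: cL; rewrite c0 (negbTE L0).
case/and3P: cL => cL c0 cW.
have [i0 i0c] := set0Pn _ c0.
have /set0Pn [j0] : W :\: c != set0.
  by apply: contraNneq cW => /eqP; rewrite setD_eq0 eqEsubset LW.
rewrite inE => /andP[j0c j0W].
case: (pickP [pred p : T * T | [&& p.1 \in c, p.2 \in W :\: c & ~~ twin L p.1 p.2]]).
  case=> i j /and3P /= [ic]; rewrite inE => /andP[jc jW] ntw.
  have hc : (i \in c) != (j \in c) by rewrite ic (negbTE jc).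
  have ij : i != j by apply: contraNneq hc => ->.
  case: t tn op tW => [//|t] tn op tW.
  have [||||//|b] := IH (W :\: [set i; j]) (cleave L i j) t (cleave_flat fL).
  - exact: cleave_sub.
  - exact: cleave_odd.
  - by have := card_setD2 ij (subsetP (LW c cL) i ic) jW; lia.
  - exact: cleave_card fL ntw cL hc Ln.
  by case/cleaveP => [b' [b'L hb ->]] E; exists b' => //; rewrite (card_cleave hb) E.
move=> none; apply: (@twins_weight L W c) => //; last 2 first.
- exact: op.
- have -> : c :\: W = set0 by apply/eqP; rewrite setD_eq0 LW.
  by rewrite cards0.
have cross i j : i \in c -> j \in W -> j \notin c -> twin L i j.
  move=> ic jW jc; have := none (i, j); rewrite /= ic inE jW jc /=.
  by move/negbT; rewrite negbK.
have base x : x \in W -> twin L x i0.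
  move=> xW; case: (boolP (x \in c)) => xc; last by apply: twin_sym; apply: cross.
  by apply: (twin_trans (j := j0)); [|apply: twin_sym]; apply: cross.
by move=> x y /base hx /base /twin_sym; apply: twin_trans.
Qed.

(** * Flats with a word congruent to the target weight *)

Definition congruent_word_forces t := forall W L z a,
  #|W| = t.*2.+2 -> flat L -> {in L, forall c, c \subset W} ->
  {in L, forall c, odd #|c| = odd t} -> 2 ^ t <= #|L| ->
  z \in L -> a \in L -> #|z| < t -> #|a| = t %[mod 4] ->
  #|z| + #|a| <= t.*2.+2 -> exists2 c : {set T}, c \in L & #|c| = t.

(** Cleaving at non-twins separated by [z] and by a word of weight #|a| lowers the target, #|z| and
    #|a| by one each, which preserves all conditions of [congruent_word_forces]. *)
Lemma congruent_word_step t W L z a : congruent_word_forces t ->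
  #|W| = t.+1.*2.+2 -> flat L -> {in L, forall c, c \subset W} ->
  {in L, forall c, odd #|c| = odd t.+1} -> 2 ^ t.+1 <= #|L| ->
  z \in L -> a \in L -> z != set0 -> a != set0 ->
  #|z| < t.+1 -> #|a| = t.+1 %[mod 4] -> #|z| + #|a| <= t.+1.*2.+2 ->
  exists2 c : {set T}, c \in L & #|c| = t.+1.
Proof.
move=> IH cW fL LW op Lt.
have Ls i j b : ~~ twin L i j -> b \in L -> (i \in b) != (j \in b) ->
    2 ^ t <= #|cleave L i j|.
  by move=> ntw bL hb; apply: cleave_card ntw bL hb Lt.
(* A word [a] lighter than the target can serve as [z] too. *)
clear Lt; wlog za : z / z = a \/ t.+1 < #|a| => [hw|] zL aL z0 a0 zt am sza.
  case: (ltngtP #|a| t.+1) => [lt|gt|]; last by exists a.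
    by apply: (hw a) => //; [left | lia].
  by apply: (hw z) => //; right.
have split_step b i j : b \in L -> #|b| = #|a| -> (i \in z) != (j \in z) ->
    (i \in b) != (j \in b) -> ~~ twin L i j -> i \in W -> j \in W ->
    exists2 c : {set T}, c \in L & #|c| = t.+1.
  move=> bL ba hz hb ntw iW jW; have ij : i != j by apply: contraNneq hz => ->.
  have [|||||||||c] // := IH (W :\: [set i; j]) (cleave L i j)
    (z :\: [set i; j]) (b :\: [set i; j]) _ (cleave_flat fL).
  - by have := card_setD2 ij iW jW; rewrite cW doubleS => -[].
  - exact: cleave_sub.
  - exact: cleave_odd.
  - exact: Ls hz.
  - by apply/cleaveP; exists z.
  - by apply/cleaveP; exists b.
  - by rewrite -ltnS -(card_cleave hz).
  - by move: am; rewrite -ba (card_cleave hb); clear; lia.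
  - by move: sza; rewrite -ba (card_cleave hz) (card_cleave hb); clear; lia.
  by case/cleaveP => [c' [c'L hc ->]] E; exists c' => //; rewrite (card_cleave hc) E.
have [i iz] := set0Pn _ z0; have iW := subsetP (LW z zL) i iz.
pose S := [set j in W | twin L i j].
have twS : {in S &, forall j k, twin L j k}.
  move=> j k; rewrite !inE => /andP[_ tj] /andP[_ tk].
  exact: twin_trans (twin_sym tj) tk.
(* Here [S] has at least t + 4 points, enough to adjust [z] on this twin class to the target
   weight. *)
case: (leqP #|W| (#|S| + #|z|)) => SW.
  apply: (twins_weight fL twS zL); first exact: op.
  have := subset_leq_card (subsetDl z S); lia.
have [j jW jSz] : exists2 j, j \in W & j \notin S :|: z.
  apply/subsetPn; apply: contraL SW => /subset_leq_card.
  by have := cardsU S z; lia.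
have out k : k \in W -> k \notin S :|: z -> (k \notin z) /\ ~~ twin L i k.
  by rewrite !inE => -> /=; rewrite negb_or => /andP[].
have hz k : k \notin z -> (i \in z) != (k \in z) by rewrite iz => /negbTE ->.
case: (pickP [pred k in W | (k \notin S :|: z) && ((i \in a) != (k \in a))]).
  move=> k /and3P[kW /(out _ kW)[kz ktw] ka].
  exact: (split_step a i k aL erefl (hz k kz) ka ktw iW kW).
move=> aout; have [jz jtw] := out j jW jSz.
have aj : (j \in a) = (i \in a).
  by have := aout j; rewrite /= jW jSz /= => /negbT; rewrite negbK => /eqP.
(* Swapping the values of [a] at [i] and its twin [k] keeps the weight and flips [i] but not [j], so
   the new word separates [i] and [j]. *)
case: (pickP [pred k in S | (i \in a) != (k \in a)]) => [k /andP[kS ka]|aS].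
  have bL : sd a (sd [set i] [set k]) \in L.
    by move: kS; rewrite inE => /andP[_ /twinP]; apply.
  apply: (split_step _ i j bL) => //; [exact: card_sd_edge|exact: hz|].
  have ik : i != k by apply: contraNneq ka => ->.
  have jk : j != k by apply: contraTneq kS => <-; move: jSz;
    rewrite inE negb_or => /andP[].
  have ji : j != i by apply: contraNneq jz => ->.
  rewrite !in_sd !in_set1 eqxx (negbTE ik) (negbTE jk) (negbTE ji) aj.
  by case: (i \in a).
have aconst k : k \in W -> k \notin z -> (k \in a) = (i \in a).
  move=> kW kz; case: (boolP (k \in S)) => kS.
    by have := aS k; rewrite /= kS /= => /negbT; rewrite negbK => /eqP.
  have := aout k; rewrite /= kW inE negb_or kS kz /= => /negbT.
  by rewrite negbK => /eqP.
(* Now [a] is constant on [i] and the points outside [z]: either it lies inside [z], against [za],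
   or it contains them all and #|z| + #|a| exceeds #|W|. *)
case: (boolP (i \in a)) => ia; last first.
  have az : a \subset z.
    apply/subsetP => k ka; apply: contraLR ia => kz.
    by rewrite negbK -(aconst k) // (subsetP (LW a aL)).
  case: za => [E|]; first by rewrite E (negbTE ia) in iz.
  by move=> /leq_trans/(_ (subset_leq_card az))/ltnW; rewrite leqNgt zt.
have : #|(i |: (W :\: z))| <= #|a|.
  apply: subset_leq_card; apply/subsetP => k; rewrite !inE.
  case/orP => [/eqP-> //|/andP[kz kW]]; by rewrite aconst.
rewrite cardsU1 !inE iz /=.
have := cardsID z W; rewrite (setIidPr (LW z zL)) cW.
by move: sza; clear; lia.
Qed.

(** * Linear codes: information sets and doubly even weights *)

Lemma linear_sd L a b : flat L -> set0 \in L -> a \in L -> b \in L -> sd a b \in L.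
Proof. by move=> fL L0 aL bL; rewrite -[sd a b]sd0; apply: fL. Qed.

(** Take [I] minimal among the sets meeting every nonzero word: minimality at [i] yields a word
    meeting [I] only in [i], an element of the systematic basis. *)
Lemma information_set L W : flat L -> set0 \in L -> {in L, forall c, c \subset W} ->
  exists I, [/\ I \subset W, {in L, forall c, c :&: I = set0 -> c = set0},
    {in I, forall i, exists2 g, g \in L & g :&: I = [set i]} &
    #|L| <= 2 ^ #|I|].
Proof.
move=> fL L0 LW; pose P I := [forall c in L, (c :&: I == set0) ==> (c == set0)].
have PW : P W.
  by apply/forall_inP => c /LW /setIidPl ->; apply/implyP.
have [I /minsetP[PI minI] IW] := minset_exists PW; exists I.
have I0 : {in L, forall c, c :&: I = set0 -> c = set0}.
  by move=> c /(forall_inP PI) /implyP h /eqP /h /eqP.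
split=> // [i iI|].
  have : ~~ P (I :\ i).
    apply: contraTN isT => /minI /(_ (subsetDl _ _)) E.
    by move: iI; rewrite -E !inE eqxx.
  rewrite negb_forall_in => /exists_inP[g gL]; rewrite negb_imply => /andP[/eqP gI g0].
  exists g => //; apply/setP => x; rewrite in_set1.
  case: (eqVneq x i) => [->|xi].
    apply: contraNT g0 => igI; apply/eqP/I0 => //; apply/setP => y.
    move/setP/(_ y): gI; rewrite !inE; case: (eqVneq y i) => [->|_] //.
    by move: igI; rewrite inE => /negbTE.
  by move/setP/(_ x): gI; rewrite !inE xi.
have inj : {in L &, injective (fun c => c :&: I)}.
  move=> a b aL bL E; apply: sd_eq0; apply: I0; first exact: linear_sd.
  apply/setP => x; move/setP/(_ x): E; rewrite !inE.
  by case: (x \in I); rewrite ?andbF // !andbT => ->; rewrite addbb.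
rewrite -(card_in_imset inj) -card_powerset; apply: subset_leq_card.
by apply/subsetP => _ /imsetP[c _ ->]; rewrite inE subsetIr.
Qed.

Lemma setI_sd a b I : sd a b :&: I = sd (a :&: I) (b :&: I).
Proof. by apply/setP => x; rewrite !inE; case: (x \in I); rewrite ?andbT ?andbF. Qed.

Lemma card_sdI a b I : #|sd a b :&: I| <= #|a :&: I| + #|b :&: I|.
Proof. rewrite setI_sd; have := card_sd (a :&: I) (b :&: I); lia. Qed.

Lemma sd_neq0 a b : a != b -> sd a b != set0.
Proof. by apply: contraNneq => /sd_eq0 ->. Qed.

(** Sums of two basis words show that basis words meet evenly. Peeling off one basis word at a time
    then carries [ortho] along with divisibility by 4. *)
Lemma doubly_even_linear L I : flat L -> set0 \in L ->
  {in L, forall c, c :&: I = set0 -> c = set0} ->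
  {in I, forall i, exists2 g, g \in L & g :&: I = [set i]} ->
  {in L, forall c, #|c :&: I| <= 2 -> 4 %| #|c|} ->
  {in L, forall c, 4 %| #|c|}.
Proof.
move=> fL L0 I0 Ig L2.
pose ortho c := forall g, g \in L -> #|g :&: I| = 1 -> ~~ odd #|c :&: g|.
have gg g g' : g \in L -> g' \in L -> #|g :&: I| = 1 -> #|g' :&: I| = 1 ->
    ~~ odd #|g :&: g'|.
  move=> gL g'L g1 g'1; have := card_sd g g'.
  have : 4 %| #|sd g g'|.
    apply: L2; first exact: linear_sd.
    by apply: (leq_trans (card_sdI _ _ _)); rewrite g1 g'1.
  have : 4 %| #|g| by apply: L2; rewrite // g1.
  have : 4 %| #|g'| by apply: L2; rewrite // g'1.
  by clear; lia.
suff H n c : #|c :&: I| <= n -> c \in L -> 4 %| #|c| /\ ortho c.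
  by move=> c cL; have [] := H _ c (leqnn _) cL.
elim: n c => [|n IH] c cn cL.
  have -> : c = set0 by apply: I0 => //; apply/eqP; rewrite -cards_eq0 -leqn0.
  by rewrite cards0; split=> // g _ _; rewrite set0I cards0.
case: (set_0Vmem (c :&: I)) => [E|[i]].
  by apply: IH; rewrite // E cards0.
rewrite inE => /andP[ic iI]; have [g gL gI] := Ig i iI.
have g1 : #|g :&: I| = 1 by rewrite gI cards1.
have [||d4 oc'] := IH (sd c g).
- have := card_sd (c :&: I) (g :&: I); rewrite -setI_sd g1.
  have -> : c :&: I :&: (g :&: I) = [set i].
    by rewrite gI; apply/setIidPr; rewrite sub1set inE ic.
  by rewrite cards1; move: cn; clear; lia.
- exact: linear_sd.
have cE : c = sd (sd c g) g by rewrite sdK.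
split=> [|g' g'L g'1]; last first.
  by rewrite cE odd_cardI_sd (negbTE (oc' g' _ _)) ?(negbTE (gg _ _ _ _ _ _)).
have : 4 %| #|g| by apply: L2; rewrite // g1.
have := card_sd (sd c g) g; rewrite -cE; have := oc' g gL g1.
by move: d4; clear; lia.
Qed.

(* [L] is self-orthogonal, so no nonzero word lies inside an information set I:
   it would meet the basis word attached to one of its points in just that
   point. Hence restriction to the complement of I is injective as well. *)
Lemma card_doubly_even_linear L W r : flat L -> set0 \in L ->
  {in L, forall c, c \subset W} -> {in L, forall c, 4 %| #|c|} ->
  #|W| <= r.*2.+1 -> #|L| <= 2 ^ r.
Proof.
move=> fL L0 LW L4 Wr; have [I [IW I0 Ig LI]] := information_set fL L0 LW.
case: (leqP #|I| r) => Ir; first by apply: (leq_trans LI); rewrite leq_exp2l.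
have cWI : #|W :\: I| <= r.
  by have := cardsID I W; rewrite (setIidPr IW); move: Wr Ir; clear; lia.
have inj : {in L &, injective (fun c => c :\: I)}.
  move=> a b aL bL E; apply/eqP; rewrite -[_ == _]negbK; apply/negP => /sd_neq0.
  set c := sd a b; have cL : c \in L by apply: linear_sd.
  have cI : c \subset I.
    apply/subsetP => x; move/setP/(_ x): E; rewrite !inE.
    by case: (x \in I) => //= ->; rewrite addbb.
  case/set0Pn => i ic; have [g gL gI] := Ig i (subsetP cI i ic).
  have cg : #|c :&: g| = 1.
    by rewrite -(setIidPl cI) -setIA [I :&: g]setIC gI (setIidPr _) ?cards1 ?sub1set.
  have := card_sd c g; rewrite cg.
  have : 4 %| #|sd c g| by apply/L4/linear_sd.
  move: (L4 c cL) (L4 g gL); clear; lia.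
rewrite -(card_in_imset inj).
apply: leq_trans (_ : #|powerset (W :\: I)| <= _); last first.
  by rewrite card_powerset leq_exp2l.
apply: subset_leq_card; apply/subsetP => _ /imsetP[c cL ->].
by rewrite inE setSD ?LW.
Qed.

(* For 2 < t.+1, a nonzero word with at most three information bits is light
   enough to be paired with a word of weight < t.+1 in [congruent_word_step], so
   if [L] avoids t.+1 its weight is t.+3 mod 4.  Comparing sums of basis words,
   this excludes 4 %| t.+1 and otherwise makes [L] doubly even, contradicting
   the weight of [a]. *)
Lemma congruent_word_linear t W L a : congruent_word_forces t ->
  #|W| = t.+1.*2.+2 -> flat L -> {in L, forall c, c \subset W} ->
  {in L, forall c, odd #|c| = odd t.+1} -> 2 ^ t.+1 <= #|L| ->
  set0 \in L -> a \in L -> #|a| = t.+1 %[mod 4] ->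
  exists2 c : {set T}, c \in L & #|c| = t.+1.
Proof.
move=> IH cW fL LW op Lt L0 aL am.
have [c /andP[cL /eqP ct]|none] := pickP [pred c in L | #|c| == t.+1].
  by exists c.
have avoid c : c \in L -> #|c| <> t.+1.
  by move=> cL /eqP E; have := none c; rewrite /= cL E.
have F z1 a1 : z1 \in L -> a1 \in L -> z1 != set0 -> a1 != set0 ->
    #|z1| < t.+1 -> #|z1| + #|a1| <= t.+1.*2.+2 -> #|a1| <> t.+1 %[mod 4].
  move=> zL a1L z0 a0 zt s am1.
  have [c cL /avoid] := congruent_word_step IH cW fL LW op Lt zL a1L z0 a0 zt am1 s.
  exact.
have [I [IW I0 Ig LI]] := information_set fL L0 LW.
have It : t.+1 <= #|I|.
  by rewrite -(leq_exp2l (m := 2)) //; exact: leq_trans Lt LI.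
clear Lt LI none.
have et : ~~ odd t.+1 by rewrite -(op _ L0) cards0.
have ev c : c \in L -> ~~ odd #|c| by move=> /op ->.
have cR : #|W :\: I| <= t.+3.
  by have := cardsID I W; rewrite (setIidPr IW); move: cW It; clear; lia.
have bound c : c \in L -> #|c| <= #|c :&: I| + t.+3.
  move=> cL; rewrite -(cardsID I c) leq_add2l (leq_trans _ cR) //.
  by apply: subset_leq_card; apply: setSD; exact: LW.
have nz c : #|c :&: I| != 0 -> c != set0.
  by apply: contraNneq => ->; rewrite set0I cards0.
have /card_gt1P [i [j [iI jI ij]]] : 1 < #|I| by move: It et; clear; lia.
have [g gL gI] := Ig i iI; have [h hL hI] := Ig j jI.
have ghI : sd g h :&: I = [set i; j] by rewrite setI_sd gI hI edgeE.
have ghL : sd g h \in L by apply: linear_sd.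
have g0 : g != set0 by apply: nz; rewrite gI cards1.
have h0 : h != set0 by apply: nz; rewrite hI cards1.
have gh0 : sd g h != set0 by apply: nz; rewrite ghI cards2 ij.
case: (ltngtP t 1) => [t0|t1|t1]; first by move: t0 et; clear; case: t.
(* For t = 1 there are six coordinates: avoiding weight 2 forces [a] to be [W], complements then
   exclude weight 4, and [W] is the only nonzero word, against [g] and [h]. *)
2: {
  have Wa : #|a| = #|W|.
    move: (avoid a aL) (subset_leq_card (LW a aL)) am cW; rewrite t1; clear; lia.
  have {Wa} Wa : a = W by apply/eqP; rewrite eqEcard LW // Wa leqnn.
  have W2 c : c \in L -> c != set0 -> c = W.
    move=> cL c0; apply/eqP; rewrite eqEcard LW //=.
    have := card_sd W c; rewrite (setIidPr (LW c cL)).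
    have : sd W c \in L by apply: linear_sd; rewrite // -Wa.
    move/avoid; move: (avoid c cL) (ev c cL) cW; rewrite t1.
    by move: c0; rewrite -card_gt0; clear; lia.
  have gh : g = h by rewrite (W2 g) // (W2 h).
  by rewrite gh sdd eqxx in gh0. }
(* If [g] and [h] are both too heavy, each weighs at least t + 3 while their union has at most t + 5
   points. So [sd g h] weighs at most 4, and avoidance excludes 4 when t = 3. *)
have [z [zL z0 zt]] : exists z, [/\ z \in L, z != set0 & #|z| < t.+1].
  case: (ltnP #|g| t.+1) => gt; first by exists g.
  case: (ltnP #|h| t.+1) => ht; first by exists h.
  exists (sd g h); split=> //.
  have ug : #|g :|: h| <= 2 + t.+3.
    rewrite -(cardsID I) leq_add //; last first.
      apply: leq_trans cR; apply: subset_leq_card; apply: setSD.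
      by rewrite subUset !LW.
    by rewrite setIUl gI hI cardsU !cards1 leq_subr.
  have := card_sd g h; have := cardsU g h.
  have := subset_leq_card (subsetIl g h); move: (avoid _ ghL).
  move: (avoid _ gL) (avoid _ hL) (ev _ gL) (ev _ hL) (ev _ ghL) gt ht ug et t1.
  by clear; lia.
(* As [t] is odd, #|c| is at most t + 5 and #|z| at most t - 1, which just meets the bound 2t + 4 in
   [F]. *)
have low c : c \in L -> c != set0 -> #|c :&: I| <= 3 -> #|c| = t.+3 %[mod 4].
  move=> cL c0 c3; have := F z c zL cL z0 c0 zt.
  move: (bound c cL) (ev c cL) (ev z zL) c3 zt et; clear; lia.
have : 4 %| t.+1 \/ 4 %| t.+3 by move: et; clear; lia.
case=> t4; last first.
  have D c : c \in L -> #|c :&: I| <= 2 -> 4 %| #|c|.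
    move=> cL c2; have [->|c0] := eqVneq c set0; first by rewrite cards0.
    by have := low c cL c0 (leqW c2); move: t4; clear; lia.
  have := doubly_even_linear fL L0 I0 Ig D aL.
  by move: am t4; clear; lia.
(* With 4 dividing t + 1, sums of one or two basis words weigh 2 mod 4, so basis words meet oddly.
   Then [sd g1 g2] meets [g3] evenly and the triple sum weighs 0 mod 4, against [low]. *)
have /card_gt2P [i1 [i2 [i3 [[I1 I2 I3] [n12 n23 n31]]]]] : 2 < #|I|.
  by move: It t1; clear; lia.
have [g1 L1 gI1] := Ig _ I1; have [g2 L2 gI2] := Ig _ I2; have [g3 L3 gI3] := Ig _ I3.
have low1 g' i' : g' \in L -> g' :&: I = [set i'] -> #|g'| = t.+3 %[mod 4].
  by move=> L' E; apply: low; rewrite // ?E ?cards1 //; apply: nz; rewrite E cards1.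
have low2 g' g'' i' i'' : g' \in L -> g'' \in L -> i' != i'' ->
    g' :&: I = [set i'] -> g'' :&: I = [set i''] -> #|sd g' g''| = t.+3 %[mod 4].
  move=> L' L'' n' E' E''; have E : sd g' g'' :&: I = [set i'; i''].
    by rewrite setI_sd E' E'' edgeE.
  by apply: low; rewrite ?E ?cards2 ?n' ?linear_sd //; apply: nz; rewrite E cards2 n'.
have pair g' g'' i' i'' : g' \in L -> g'' \in L -> i' != i'' ->
    g' :&: I = [set i'] -> g'' :&: I = [set i''] -> odd #|g' :&: g''|.
  move=> L' L'' n' E' E''; have := low2 _ _ _ _ L' L'' n' E' E''.
  have := card_sd g' g''; have := low1 _ _ L' E'; have := low1 _ _ L'' E''.
  by move: t4; clear; lia.
rewrite eq_sym in n31.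
have o13 := pair _ _ _ _ L1 L3 n31 gI1 gI3.
have o23 := pair _ _ _ _ L2 L3 n23 gI2 gI3.
have L12 := linear_sd fL L0 L1 L2; have L123 := linear_sd fL L0 L12 L3.
have o123 := odd_cardI_sd g1 g2 g3; rewrite o13 o23 /= in o123.
have : #|sd (sd g1 g2) g3| = t.+3 %[mod 4].
  apply: low => //.
    apply: nz; apply: contraTneq isT => c0.
    by have := odd_cardI_sd (sd g1 g2) g3 I; rewrite c0 odd_cardI_sd gI1 gI2 gI3 !cards1.
  have := card_sdI (sd g1 g2) g3 I; have := card_sdI g1 g2 I.
  by rewrite gI1 gI2 gI3 !cards1; clear; lia.
have := card_sd (sd g1 g2) g3; have := low1 _ _ L3 gI3.
have := low2 _ _ _ _ L1 L2 n12 gI1 gI2.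
by move: t4 o123; clear; lia.
Qed.

(** A rank-nullity count: a fibre translated by one of its members lands in the kernel. *)
Lemma card_flat_fiber (R : finType) (f : {set T} -> R) L :
  flat L -> set0 \in L ->
  (forall a b, a \in L -> b \in L -> f a = f b -> f (sd a b) = f set0) ->
  #|L| <= #|f @: L| * #|[set c in L | f c == f set0]|.
Proof.
move=> fL L0 fsd; rewrite -sum1_card (partition_big_imset f) -sum_nat_const.
apply: leq_sum => _ /imsetP[b bL ->]; rewrite sum1dep_card.
rewrite -(card_imset _ (@sd_inj b)); apply: subset_leq_card.
apply/subsetP => _ /imsetP[c + ->]; rewrite !inE => /andP[cL /eqP E].
by rewrite linear_sd //= fsd.
Qed.

(** The step requires nonempty [z] and [a], which is automatic unless the flat contains [set0], the
    linear case. *)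
Lemma congruent_word t : congruent_word_forces t.
Proof.
elim: t => [|t IH] W L z a cW fL LW op Lt zL aL zt am sza; first by [].
have [L0|nL0] := boolP (set0 \in L).
  exact: congruent_word_linear IH cW fL LW op Lt L0 aL am.
have n0 c : c \in L -> c != set0 by apply: contraTneq => ->.
apply: (congruent_word_step IH cW fL LW op Lt zL aL) => //; exact: n0.
Qed.

Lemma linear_weight_2mod4 t W L : flat L -> set0 \in L ->
  {in L, forall c, c \subset W} -> {in L, forall c, ~~ odd #|c|} ->
  #|W| = t.*2 + 5 -> 2 ^ (t + 3) <= #|L| -> t %% 4 = 2 ->
  exists2 c : {set T}, c \in L & #|c| = t.
Proof.
move=> fL L0 LW ev cW Lt tm.
have [c /andP[cL /eqP ct]|none] := pickP [pred c in L | #|c| == t].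
  by exists c.
suff L4 : {in L, forall c, 4 %| #|c|}.
  have Wr : #|W| <= (t + 2).*2.+1 by rewrite cW; clear; lia.
  have := leq_trans Lt (card_doubly_even_linear fL L0 LW L4 Wr).
  by rewrite leq_exp2l // leq_add2l.
move=> a aL; apply/negPn/negP => a4.
have aW := subset_leq_card (LW a aL); have ea := ev a aL.
(* Modulo 4, #|W| is 1 and #|a| is 2, so at least three coordinates lie outside [a]; shortening
   there keeps [a]. *)
have [S SWa cS] : exists2 S : {set T}, S \subset W :\: a & #|S| = 3.
  apply: subset_of_card; have := cardsID a W; rewrite (setIidPr (LW a aL)).
  by move: aW ea cW tm a4; clear; lia.
pose LS := [set c in L | c :&: S == set0].
have LSE c : c \in LS -> c \in L /\ c :&: S = set0.
  by rewrite inE => /andP[? /eqP].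
have fLS : flat LS.
  move=> x y z /LSE [xL xS] /LSE [yL yS] /LSE [zL zS].
  by rewrite inE fL //= !setI_sd xS yS zS !sd0.
have cLS : 2 ^ t <= #|LS|.
  have := card_flat_fiber (f := fun c => c :&: S) fL L0.
  have fsd x y : x \in L -> y \in L -> x :&: S = y :&: S ->
      sd x y :&: S = set0.
    by move=> _ _ E; rewrite setI_sd E sdd.
  rewrite set0I => /(_ fsd)/(leq_trans Lt); rewrite -/LS.
  have im8 : #|[set c :&: S | c in L]| <= 8.
    rewrite -[8]/(2 ^ 3) -cS -card_powerset; apply: subset_leq_card.
    by apply/subsetP => _ /imsetP[c _ ->]; rewrite inE subsetIr.
  rewrite expnD => /leq_trans/(_ (leq_mul im8 (leqnn _))).
  by rewrite mulnC leq_pmul2l.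
have [c cL ct] : exists2 c : {set T}, c \in LS & #|c| = t.
  apply: (@congruent_word t (W :\: S) LS set0 a) => //.
  - have := cardsID S W; rewrite (setIidPr (subset_trans SWa (subsetDl _ _))) cS cW.
    by clear; lia.
  - move=> c /LSE [cL cS0]; rewrite subsetD LW //= -setI_eq0 cS0 //.
  - move=> c /LSE [cL _]; rewrite (negbTE (ev c cL)).
    by move: tm; clear; lia.
  - by rewrite inE L0 set0I eqxx.
  - rewrite inE aL setI_eq0 disjoint_sym; move: SWa; rewrite subsetD.
    by case/andP.
  - by rewrite cards0; move: tm; clear; lia.
  - by move: a4 ea tm; clear; lia.
  - rewrite cards0 add0n; have := cardsID a W; rewrite (setIidPr (LW a aL)).
    by have := subset_leq_card SWa; rewrite cS; move: cW; clear; lia.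
by have [cL1 _] := LSE c cL; have := none c; rewrite /= cL1 ct eqxx.
Qed.

End Words.

(** * Sequences and sets of vectors *)

Lemma F2_natr_eq0 n : (n%:R == 0 :> 'F_2)%R = ~~ odd n.
Proof. by rewrite -(dvdn_pcharf (pchar_Fp (isT : prime 2))) dvdn2. Qed.

Lemma F2_sum_bool (I : finType) (J : {set I}) (b : pred I) :
  (\sum_(i in J) (b i)%:R == 0 :> 'F_2)%R = ~~ odd #|J :&: [set i | b i]|.
Proof.
rewrite -F2_natr_eq0 -sum1_card natr_sum; congr (_ == _).
rewrite (eq_bigl (fun i => (i \in J) && b i)); last by move=> i; rewrite !inE.
by rewrite [RHS]big_mkcondr; apply: eq_bigr => i _; case: (b i).
Qed.

Lemma F2_rowDD d (x : 'rV['F_2]_d) : (x + x = 0)%R.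
Proof.
apply/rowP => j; rewrite !mxE -mulr2n -mulr_natr.
by rewrite (eqP (_ : 2%:R == 0 :> 'F_2)%R) ?mulr0 // F2_natr_eq0.
Qed.

Lemma sum_sd (I : finType) d (v : I -> 'rV['F_2]_d) (a b : {set I}) :
  (\sum_(i in sd a b) v i = \sum_(i in a) v i + \sum_(i in b) v i)%R.
Proof.
rewrite big_mkcond [in RHS]big_mkcond [X in (_ + X)%R]big_mkcond -big_split.
apply: eq_bigr => i _; rewrite in_sd.
by case: (i \in a); case: (i \in b); rewrite /= ?addr0 ?add0r ?F2_rowDD.
Qed.

Lemma forces_of_codes n d k :
  (forall L : {set {set 'I_k}}, flat L -> set0 \in L ->
     {in L, forall c : {set 'I_k}, ~~ odd #|c|} -> 2 ^ k <= 2 ^ d.+1 * #|L| ->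
     exists2 c : {set 'I_k}, c \in L & #|c| = n) ->
  forces_zero_sum n d k.
Proof.
move=> H; apply/forallP => s.
pose f (J : {set 'I_k}) := ((\sum_(i in J) tnth s i)%R, odd #|J|).
have f_sd a b : f (sd a b) = ((f a).1 + (f b).1, (f a).2 (+) (f b).2)%R.
  by rewrite /f sum_sd odd_card_sd.
have f0 : f set0 = (0%R, false) by rewrite /f big_set0 cards0.
pose L := [set J | f J == f set0].
have LE J : J \in L -> f J = (0%R, false) by rewrite inE f0 => /eqP.
have [||||c cL cn] := H L.
- move=> a b c /LE a0 /LE b0 /LE c0; rewrite inE !f_sd a0 b0 c0 f0 /=.
  by rewrite !addr0.
- by rewrite inE eqxx.
- by move=> c /LE [_ ->].
- have cT : #|[set: {set 'I_k}]| = 2 ^ k.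
    by rewrite -powersetT card_powerset cardsT card_ord.
  rewrite -cT; apply: (leq_trans (card_flat_fiber (f := f) _ (in_setT _) _)).
    by move=> *; apply: in_setT.
    by move=> a b _ _ E; rewrite f_sd E f0 addbb F2_rowDD.
  apply: leq_mul; last by apply: subset_leq_card; apply/subsetP => J; rewrite !inE.
  apply: leq_trans (max_card _) _.
  by rewrite card_prod card_mx card_Fp // card_bool mul1n expnSr.
have sz : size [seq tnth s i | i <- enum c] == n by rewrite size_map -cardE cn.
apply/existsP; exists (Tuple sz); apply/andP; split => /=.
  rewrite -[X in subseq _ X](map_tnth_enum s); apply: map_subseq.
  by rewrite enumT /(enum _); apply: filter_subseq.
by rewrite big_map big_enum; have [-> _] := LE _ cL.
Qed.

(** * Lower bounds from indexed families *)

Definition zero_sum_free_family (n d : nat) (I : finType) (v : I -> 'rV['F_2]_d) :=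
  injective v /\ forall J : {set I}, #|J| = n -> (\sum_(i in J) v i != 0)%R.

Lemma beta2_ge m d (I : finType) (v : I -> 'rV['F_2]_d) :
  zero_sum_free_family (2 * m) v -> #|I| <= beta2 m d.
Proof.
case=> vI v0; rewrite -cardsT -(card_imset _ vI).
apply: (@leq_bigmax_cond _ _ (fun A : {set 'rV['F_2]_d} => #|A|)).
apply/forallP => B; apply/implyP => /andP[BA /eqP cB].
have BE : B = v @: (v @^-1: B).
  apply/setP => x; apply/idP/imsetP => [xB|[i]]; last by rewrite inE => ? ->.
  have /imsetP[i _ xi] := subsetP BA x xB; exists i => //.
  by rewrite inE -xi.
rewrite BE big_imset; last by move=> i j _ _ /vI.
by apply: v0; rewrite -(card_imset _ vI) -BE.
Qed.

(** Only the new point has a nonzero last coordinate, so no zero-sum subfamily contains it. *)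
Lemma zero_sum_free_family_option n d (I : finType) (v : I -> 'rV['F_2]_d) :
  zero_sum_free_family n v ->
  zero_sum_free_family n (fun o : option I =>
    row_mx (oapp v 0 o) (const_mx (o == None)%:R) : 'rV['F_2]_(d + 1))%R.
Proof.
case=> vI v0; split.
  move=> [i|] [j|] /eq_row_mx [Ev /rowP/(_ ord0)/eqP]; rewrite !mxE //.
  by move: Ev => /= /vI ->.
move=> J cJ; apply/eqP => /rowP E.
have : ~~ odd #|J :&: [set o | o == None]|.
  rewrite -F2_sum_bool; apply/eqP; have := E (rshift d ord0).
  rewrite summxE !mxE => sE; rewrite -[RHS]sE; apply: eq_bigr => o _.
  by rewrite row_mxEr mxE.
have [JN|JN _] := boolP (None \in J).
  suff -> : J :&: [set o | o == None] = [set None] by rewrite cards1.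
  by apply/setP => o; rewrite !inE andbC; case: eqP => // ->.
have JE : J = Some @: (Some @^-1: J).
  apply/setP => -[i|]; last first.
    by rewrite (negbTE JN); apply/esym/imsetP => -[].
  by rewrite mem_imset ?inE //; apply: Some_inj.
have := v0 (Some @^-1: J); rewrite -(card_imset _ (@Some_inj _)) -JE => /(_ cJ).
case/eqP; apply/rowP => j; have := E (lshift 1 j).
rewrite summxE !mxE {1}JE big_imset /=; last by move=> ? ? _ _ [].
by rewrite summxE => sE; rewrite -[RHS]sE; apply: eq_bigr => i _; rewrite row_mxEl.
Qed.

Lemma card_slices (I : finType) (J : {set I * bool}) :
  #|J| = #|[set f | (f, false) \in J]| + #|[set f | (f, true) \in J]|.
Proof.
have inj (x : bool) : injective (fun f : I => (f, x)) by move=> ? ? [].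
have slice (x : bool) : #|[set f | (f, x) \in J]| = #|[set p in J | p.2 == x]|.
  rewrite -(card_imset _ (inj x)); congr #|pred_of_set _|.
  apply/setP => -[f y]; rewrite !inE /=; apply/imsetP/andP.
    by case=> g; rewrite inE => Jg [-> ->].
  by case=> Jf /eqP <-; exists f; rewrite ?inE.
rewrite !slice addnC -(cardsID [set p | p.2] J).
by congr (_ + _); congr #|pred_of_set _|;
  apply/setP => -[f []]; rewrite !inE ?andbT ?andbF.
Qed.

(* Over each base point the family has a pair of points differing in the last
   coordinate only: [J] has the form J0 x {0} + J1 x {1}, and X = J0 + J1. *)
Lemma zero_sum_free_family_double m e (I : finType) (base : I -> 'I_e -> bool) :
  odd m ->
  (forall X : {set I}, ~~ odd #|X| ->
     (forall j, ~~ odd #|X :&: [set f | base f j]|) ->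
     X = set0 \/ X = setT /\ 4 %| #|I|) ->
  zero_sum_free_family (2 * m) (fun p : I * bool =>
    row_mx (\row_j (base p.1 j)%:R) (const_mx p.2%:R) : 'rV['F_2]_(e + 1))%R.
Proof.
move=> om H; split.
  move=> [f x] [g y] /eq_row_mx [/rowP Ef /rowP/(_ ord0)]; rewrite !mxE => Ex.
  have -> : x = y by move: Ex; clear; case: x; case: y.
  have {}Ef j : base f j = base g j.
    by have := Ef j; rewrite !mxE; case: (base f j); case: (base g j).
  have [-> //|fg] := eqVneq f g.
  have fg2 : #|[set f; g]| = 2 by rewrite cards2 fg.
  have [||E|[E]] := H [set f; g].
  - by rewrite fg2.
  - move=> j; case bf: (base f j).
      rewrite (setIidPl _) ?fg2 //; apply/subsetP => h.
      by rewrite !inE => /orP[] /eqP ->; rewrite -?Ef.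
    rewrite (_ : _ :&: _ = set0) ?cards0 //; apply/setP => h; rewrite !inE.
    by apply/negP => /andP[/orP[] /eqP ->]; rewrite -?Ef bf.
  - by rewrite E cards0 in fg2.
  - by rewrite -cardsT -E fg2.
move=> J cJ; apply/eqP => /rowP E.
pose J0 := [set f | (f, false) \in J]; pose J1 := [set f | (f, true) \in J].
have cJ01 : #|J| = #|J0| + #|J1| := card_slices J.
have base_slices (P : pred I) :
    #|J :&: [set p | P p.1]| = #|J0 :&: [set f | P f]| + #|J1 :&: [set f | P f]|.
  rewrite card_slices.
  by congr (_ + _); congr #|pred_of_set _|; apply/setP => f; rewrite !inE.
have odd1 : ~~ odd #|J1|.
  have -> : #|J1| = #|J :&: [set p | p.2]|.
    rewrite card_slices -[LHS]add0n -(@cards0 I).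
    by congr (_ + _); congr #|pred_of_set _|;
      apply/setP => f; rewrite !inE ?andbT ?andbF.
  rewrite -F2_sum_bool; apply/eqP; have := E (rshift e ord0).
  rewrite summxE mxE => sE; rewrite -[RHS]sE; apply: eq_bigr => p _.
  by rewrite row_mxEr mxE.
have := card_sd J0 J1; rewrite -cJ01 cJ.
(* If [X] is empty, both slices equal [J1], of even size; if [X] is everything, they are
   complementary and #|J| = #|I|. Either way 4 divides 2m, although [m] is odd. *)
have [||/[dup] X0 /sd_eq0 ->|[XT I4]] := H (sd J0 J1).
- by rewrite odd_card_sd -oddD -cJ01 cJ oddM.
- move=> j; rewrite odd_cardI_sd -oddD -(base_slices (base^~ j)).
  rewrite -F2_sum_bool; apply/eqP; have := E (lshift 1 j).
  by rewrite summxE mxE => sE; rewrite -[RHS]sE; apply: eq_bigr => p _; rewrite row_mxEl mxE.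
- by rewrite sdd cards0 setIid; move: odd1 om; clear; lia.
have -> : J0 :&: J1 = set0.
  apply/setP => f; move/setP/(_ f): XT.
  by rewrite in_sd !inE; do 2!case: (_ \in J).
by rewrite XT cardsT cards0; move: I4 om; clear; lia.
Qed.

(** The base points 0 ([None]) and e_j are affinely independent, so only the empty [X] arises. *)
Lemma beta2_ge_double m d : odd m -> 0 < d -> 2 * d <= beta2 m d.
Proof.
case: d => // e om _; rewrite -addn1.
have [] := @zero_sum_free_family_double m e (option 'I_e)
  (fun f j => f == Some j) om.
  move=> X eX eXj; left.
  have XS j : Some j \notin X.
    apply: contra (eXj j) => jX; rewrite (setIidPr _) ?sub1set.
      by rewrite (_ : [set f | _] = [set Some j]) ?cards1 //; apply/setP => f; rewrite !inE.
    by apply/subsetP => f; rewrite inE => /eqP ->.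
  apply/eqP; rewrite -cards_eq0; have : #|X| <= 1.
    rewrite -(cards1 (@None 'I_e)); apply: subset_leq_card; apply/subsetP => -[j|].
      by rewrite (negbTE (XS j)).
    by rewrite inE.
  by move: eX; clear; lia.
move=> vI v0; have := beta2_ge (conj vI v0).
by rewrite card_prod card_option card_ord card_bool mulnC addn1.
Qed.

(** [None] encodes the all-ones vector and [Some None] zero. At coordinate j only the all-ones
    vector and e_j are nonzero, so [X] contains all of these or none; parity then decides about
    zero. *)
Lemma zero_sum_free_family_mod4 m d : odd m -> d %% 4 = 3 ->
  exists (I : finType) (v : I -> 'rV['F_2]_d),
    zero_sum_free_family (2 * m) v /\ #|I| = 2 * d.+1.
Proof.
case: d => // e om e4; rewrite -[e.+1]addn1.
eexists; eexists; split; last first.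
  2: apply: (@zero_sum_free_family_double m e (option (option 'I_e))
  (fun f j => (f == None) || (f == Some (Some j))) om).
  by rewrite card_prod !card_option card_ord card_bool addn1 mulnC.
move=> X eX eXj; rewrite !card_option card_ord.
have NS j : (Some (Some j) \in X) = (None \in X).
  apply/eqP; apply: contraNT (eXj j) => ne.
  rewrite (_ : [set f | _] = [set None; Some (Some j)]) ?card_edgeI 1?eq_sym //.
  by apply/setP => f; rewrite !inE.
have [NX|NX] := boolP (None \in X); [right|left].
  split; last by move: e4; clear; lia.
  have cC : #|~: X| <= 1.
    rewrite -(cards1 (Some (@None 'I_e))); apply: subset_leq_card.
    apply/subsetP => -[[j|]|]; rewrite !inE ?NX //.
    by rewrite NS NX.
  apply/eqP; rewrite eqEcard subsetT /= cardsT -(cardsC X).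
  have := cardsC X; rewrite !card_option card_ord.
  by move: cC eX e4; clear; move: #|X| #|~: X| => x y; lia.
apply/eqP; rewrite -cards_eq0; have : #|X| <= 1.
  rewrite -(cards1 (Some (@None 'I_e))); apply: subset_leq_card.
  apply/subsetP => -[[j|]|]; rewrite ?inE ?NS ?(negbTE NX) //.
by move: eX; clear; lia.
Qed.

(** * Comparing sets with sequences, and the five dimensions *)

Lemma beta2_lt_s2 m d : 0 < m -> beta2 m d < s2 m d.
Proof.
move=> m0; rewrite /s2; case: ex_minnP => k /forallP force _.
have small (A : {set 'rV['F_2]_d}) : zero_sum_free (2 * m) A -> #|A| < k.
  move=> /forallP Afree; rewrite ltnNge; apply/negP => kA.
  have sk : size (take k (enum A)) == k by rewrite size_takel -?cardE.
  have /existsP[t /andP[ts /eqP t0]] := force (Tuple sk).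
  have ut : uniq t by apply: subseq_uniq ts _; rewrite take_uniq ?enum_uniq.
  have := Afree [set x in tval t]; rewrite cardsE (card_uniqP ut) size_tuple eqxx andbT.
  move=> /implyP; rewrite -{2}t0 big_uniq //=.
  have -> : [set x in tval t] \subset A.
    apply/subsetP => x; rewrite inE => /(mem_subseq ts)/mem_take.
    by rewrite mem_enum.
  move=> /(_ isT)/eqP; apply; rewrite -{}t0 big_uniq //=.
  by apply: eq_bigl => x; rewrite inE.
have k0 : 0 < k.
  apply: leq_ltn_trans (small set0 _); first exact: leq0n.
  apply/forallP => B; apply/implyP; rewrite subset0 => /andP[/eqP->].
  by rewrite cards0 eq_sym muln_eq0 /= => /eqP m00; rewrite m00 in m0.
rewrite -(prednK k0) ltnS; apply/bigmax_leqP => A /small.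
by rewrite -{1}(prednK k0).
Qed.

Lemma s2_le m d k : forces_zero_sum (2 * m) d k -> s2 m d <= k.
Proof. by move=> h; rewrite /s2; case: ex_minnP => n _; apply. Qed.

Lemma codimension_bound k d r x : k = d.+1 + r -> 2 ^ k <= 2 ^ d.+1 * x -> 2 ^ r <= x.
Proof. by move=> ->; rewrite expnD leq_pmul2l // expn_gt0. Qed.

Theorem theorem13 (m d : nat) (hm : 3 <= m) (hodd : odd m)
    (hdl : 2 * m - 3 <= d) (hdu : d <= 2 * m + 1) :
  beta2 m d = s2 m d - 1.
Proof.
have m0 : 0 < m by exact: leq_trans hm.
have lt := beta2_lt_s2 d m0.
suff [N Nb sN] : exists2 N, N <= beta2 m d & s2 m d <= N.+1.
  by move: lt Nb sN; clear; lia.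
have subT k (c : {set 'I_k}) : c \subset setT by apply: subsetT.
(* Length 2m + d leaves dimension 2m - 1, and [dm] bounds the length by 2(2m - 1) + 1. *)
have low : d <= 2 * m - 1 -> s2 m d <= 2 * m + d.
  move=> dm; apply/s2_le/forces_of_codes => L fL L0 ev Lk.
  apply: (@flat_middle_weight _ (2 * m - 1) setT L (2 * m) fL) => //.
  - by move=> c /ev/negbTE ->; rewrite oddM.
  - by rewrite cardsT card_ord; move: dm; clear; lia.
  - by apply: codimension_bound Lk; move: m0; clear; lia.
  - by move: m0; clear; lia.
have e4 : (2 * m - 3) %% 4 = 3 by move: hm hodd; clear; lia.
have [I [v [fv cI]]] := zero_sum_free_family_mod4 hodd e4.
have : d = 2 * m - 3 \/ d = 2 * m - 3 + 1 \/ d = 2 * m - 3 + 1 + 1 \/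
  d = 2 * m \/ d = 2 * m + 1 by move: hdl hdu; clear; lia.
case=> [dE|[dE|[dE|[dE|dE]]]]; clear lt hdl hdu.
- exists #|I|; first by rewrite dE; exact: beta2_ge fv.
  apply: leq_trans (low _) _; rewrite ?cI dE; move: hm; clear; lia.
- exists #|I|.+1.
    rewrite dE -card_option; exact: beta2_ge (zero_sum_free_family_option fv).
  apply: leq_trans (low _) _; rewrite ?cI dE; move: hm; clear; lia.
- exists #|I|.+2.
    rewrite dE -!card_option.
    exact: beta2_ge (zero_sum_free_family_option (zero_sum_free_family_option fv)).
  apply: leq_trans (low _) _; rewrite ?cI dE; move: hm; clear; lia.
- exists (2 * d); first by apply: beta2_ge_double; rewrite // dE muln_gt0.
  apply/s2_le/forces_of_codes => L fL L0 ev Lk.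
  apply: (@flat_middle_weight _ (2 * m) setT L (2 * m) fL) => //.
  + by move=> c /ev/negbTE ->; rewrite oddM.
  + by rewrite cardsT card_ord dE -mul2n.
  + by apply: codimension_bound Lk; rewrite dE; clear; lia.
  + by rewrite leqnn leqnSn.
have d4 : d %% 4 = 3 by rewrite dE; move: hodd; clear; lia.
have [I' [v' [fv' cI']]] := zero_sum_free_family_mod4 hodd d4.
(* With t = 2m, one more than #|I'| is 4m + 5 = 2t + 5, and the code dimension is at least t + 3. *)
exists #|I'|; first exact: beta2_ge fv'.
rewrite cI'; apply/s2_le/forces_of_codes => L fL L0 ev Lk.
apply: (@linear_weight_2mod4 _ (2 * m) setT L fL) => //.
- by rewrite cardsT card_ord dE; clear; lia.
- by apply: codimension_bound Lk; rewrite dE; clear; lia.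
- by move: hodd; clear; lia.
Qed.
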